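(* Let $(n,k,r)$ be an admissible triple of parameters, i.e. $n\in\mathbb{N}$, $k\in\{0,\ldots,n\}$, $r\in[0,\infty)$ and $\max\{k,r\}>0$. Then the variance of an $r$-Lah distributed random variable $\mathrm{Lah}(n,k)_r$ is given by $$\begin{aligned} &\mathrm{Var}[\mathrm{Lah}(n,k)_r]=\frac{1}{(n-k+1)(n-k+2)}\biggl(\bigl(r(n^2+3n+2)+k^2(n+r)+k(n^2+r+2nr)\bigr)\bigl(H_{n+2r}-H_{k+2r-1}\bigr)\\ &\quad-\bigl(r^2(n^2+3n+2)+k^2(n+r)^2+k(2n^2r+r(2+r)+n(1+2r+2r^2))\bigr)\bigl(H^{(2)}_{n+2r}-H^{(2)}_{k+2r-1}\bigr)\\ &\quad-\left(\frac{k(n+1)(n+2r)(k+2r-1)}{n-k+1}\right)\bigl(H_{n+2r}-H_{k+2r-1}\bigr)^2\biggr)-\frac{rn+r^2}{(n+2r)^2}. \end{aligned}$$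
   Context: $\mathbb{N}=\{1,2,\ldots\}$, $\mathbb{N}_0=\mathbb{N}\cup\{0\}$. Let $\genfrac{[}{]}{0pt}{}{n}{k}$ and $\genfrac{\{}{\}}{0pt}{}{n}{k}$ be the (unsigned) Stirling numbers of the first kind (number of permutations of $\{1,\dots,n\}$ with exactly $k$ cycles) and of the second kind (number of partitions of $\{1,\dots,n\}$ into $k$ non-empty subsets). For $n\in\mathbb{N}_0$, $k\in\{0,\ldots,n\}$ and $r\in\mathbb{R}$ the $r$-Stirling numbers are defined (with $0^0=1$) by $$\genfrac{[}{]}{0pt}{}{n}{k}_r=\sum_{j=k}^n\genfrac{[}{]}{0pt}{}{n}{j}\binom{j}{k}r^{j-k},\qquad \genfrac{\{}{\}}{0pt}{}{n}{k}_r=\sum_{j=k}^n\binom{n}{j}\genfrac{\{}{\}}{0pt}{}{j}{k}r^{n-j}.$$ The $r$-Lah number is $L(n,k)_r=\sum_{j=k}^n\genfrac{[}{]}{0pt}{}{n}{j}_r\genfrac{\{}{\}}{0pt}{}{j}{k}_r$. For an admissible triple $(n,k,r)$, $\mathrm{Lah}(n,k)_r$ denotes a random variable with the $r$-Lah distribution $$\mathbb{P}[\mathrm{Lah}(n,k)_r=j]=\frac{1}{L(n,k)_r}\genfrac{[}{]}{0pt}{}{n}{j}_r\genfrac{\{}{\}}{0pt}{}{j}{k}_r,\qquad j\in\{k,k+1,\ldots,n\}.$$ Harmonic differences with real arguments: for integer $m\in\mathbb{N}_0$ and real $\alpha>-1$, $H_{\alpha+m}-H_\alpha:=\sum_{i=1}^{m}\frac{1}{\alpha+i}$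 and $H^{(2)}_{\alpha+m}-H^{(2)}_\alpha:=\sum_{i=1}^{m}\frac{1}{(\alpha+i)^2}$. *)

(* Defs.v *)
From HB Require Import structures.
From mathcomp Require Import all_boot all_order all_fingroup all_algebra.
From mathcomp Require Import all_classical all_reals all_analysis.

Set Implicit Arguments.
Unset Strict Implicit.
Unset Printing Implicit Defensive.

Import Order.TTheory GRing.Theory Num.Theory.
Import numFieldNormedType.Exports.

Local Open Scope ring_scope.

(* [porbits s] is the set of all cycles of [s], fixed points included. *)
Definition stirling1 (n k : nat) : nat :=
  #|[pred s : 'S_n | #|porbits s| == k]|.

(* [finset.partition] requires the blocks to be non-empty. *)
Definition stirling2 (n k : nat) : nat :=
  #|[pred B : {set {set 'I_n}} | finset.partition B [set: 'I_n]%SET & #|B| == k]|.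

Definition rstirling1 (R : realType) (r : R) (n k : nat) : R :=
  \sum_(k <= j < n.+1) (stirling1 n j)%:R * 'C(j, k)%:R * r ^+ (j - k).

Definition rstirling2 (R : realType) (r : R) (n k : nat) : R :=
  \sum_(k <= j < n.+1) 'C(n, j)%:R * (stirling2 j k)%:R * r ^+ (n - j).

Definition rLah (R : realType) (r : R) (n k : nat) : R :=
  \sum_(k <= j < n.+1) rstirling1 r n j * rstirling2 r j k.

Definition rLah_distributed (R : realType) (d : measure_display)
    (T : measurableType d) (P : probability T R) (X : {RV P >-> R})
    (n k : nat) (r : R) : Prop :=
  forall j : nat, (k <= j <= n)%N ->
    distribution P X [set j%:R]%classic
    = ((rLah r n k)^-1 * (rstirling1 r n j * rstirling2 r j k))%:E.

(* H^(p)_(a + m) - H^(p)_a, for real a > -1. *)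
Definition harmonic_diff (R : realType) (p : nat) (a : R) (m : nat) : R :=
  \sum_(1 <= i < m.+1) ((a + i%:R) ^+ p)^-1.

Definition rLah_admissible (R : realType) (n k : nat) (r : R) : Prop :=
  [/\ (0 < n)%N, (k <= n)%N, 0 <= r & 0 < Num.max k%:R r].

(* Main.v *)
Require Import Defs.
From HB Require Import structures.
From mathcomp Require Import all_boot all_order all_fingroup all_algebra.
From mathcomp Require Import all_classical all_reals all_analysis.
From mathcomp Require Import measurable_realfun ring zify.

Import Order.TTheory GRing.Theory Num.Theory.
Import numFieldNormedType.Exports.

Local Open Scope ring_scope.

(* Write q_n(x) = x (x + 1) ... (x + n - 1) and D for the forward difference
   operator. The r-Stirling numbers of the first kind are the coefficients of
   q_n(x + r), and k! {j k}_r is the k-th difference of x^j at x = r. Hence the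
   i-th factorial moment of the r-Lah weights is (1 / k!) D^k (x^i q_n^(i)(x + r))
   evaluated at x = r. As D commutes with differentiation and
   D^k q_n(x) = n (n - 1) ... (n - k + 1) q_(n - k)(x + k), a Leibniz rule for
   D^k (x f) expresses the first two moments through q_m, q_m' and q_m'' at k + 2 r
   for m = n - k, n - k + 1, n - k + 2; the logarithmic derivatives of q_m are
   the harmonic differences. *)

(** * Cycle counts and Stirling numbers of the first kind *)

Lemma porbit_lift_perm n (s : 'S_n) (x : 'I_n) :
  porbit (lift_perm ord0 ord0 s) (lift ord0 x) = (lift ord0 @: porbit s x)%SET.
Proof.
have liftX i : ((lift_perm ord0 ord0 s) ^+ i)%g (lift ord0 x) = lift ord0 ((s ^+ i)%g x).
  by elim: i => [|i IH]; rewrite ?expg0 ?perm1 // !expgSr !permM IH lift_perm_lift.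
apply/finset.setP => y; apply/porbitP/finset.imsetP => [[i ->]|[z /porbitP[i ->] ->]].
  by exists ((s ^+ i)%g x); rewrite ?mem_porbit ?liftX.
by exists i; rewrite liftX.
Qed.

(** The fixed point 0 contributes a singleton cycle; the other cycles are the [lift] images of those
    of [s]. *)
Lemma card_porbits_lift_perm n (s : 'S_n) :
  #|porbits (lift_perm ord0 ord0 s)| = #|porbits s|.+1.
Proof.
pose L := lift_perm ord0 ord0 s.
have L0 : porbit L ord0 = [set ord0]%SET.
  apply/finset.setP => y; rewrite finset.in_set1; apply/porbitP/eqP => [[i ->]|->].
    by elim: i => [|i IH]; rewrite ?expg0 ?perm1 // expgSr permM IH lift_perm_id.
  by exists 0%N; rewrite expg0 perm1.
have -> : porbits L
  = ([set ord0] |: [set (lift ord0 @: A)%SET | A : {set 'I_n} in porbits s])%SET.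
  apply/finset.setP => A; rewrite finset.in_setU1; apply/finset.imsetP/orP => [[x _ ->]|].
    case: (unliftP ord0 x) => [y|] ->; last by left; rewrite L0.
    by right; rewrite porbit_lift_perm; apply/imset_f/imset_f.
  case=> [/eqP->|/finset.imsetP[B /finset.imsetP[x _ ->] ->]]; first by exists ord0.
  by exists (lift ord0 x); rewrite ?porbit_lift_perm.
rewrite finset.cardsU1 finset.card_imset; last exact: (imset_inj (@lift_inj _ _)).
case: finset.imsetP => // -[B _ E0].
have: ord0 \in (lift ord0 @: B)%SET by rewrite -E0 finset.in_set1.
by case/finset.imsetP => x _ /eqP; rewrite (negPf (neq_lift _ _)).
Qed.

(* Every permutation is uniquely a permutation fixing 0 precomposed with some
   transposition (0 i). *)
Lemma sum_perm_recl (R : nmodType) n (F : 'S_n.+1 -> R) :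
  \sum_s F s
  = \sum_(i < n.+1) \sum_(s : 'S_n) F (tperm ord0 i * lift_perm ord0 ord0 s)%g.
Proof.
(* Products act left factor first, so (0 i) followed by a permutation fixing 0 sends i to 0: the
   outer index is the preimage of 0. *)
rewrite (partition_big (fun s : 'S_n.+1 => s^-1 ord0)%g xpredT) //=.
apply: eq_bigr => i _.
rewrite (reindex_inj (mulgI (tperm ord0 i))) /=.
pose ulsf (s : 'S_n.+1) j := odflt j (unlift ord0 (s (lift ord0 j))).
have ulsfK (s : 'S_n.+1) : s ord0 = ord0 -> forall j, lift ord0 (ulsf s j) = s (lift ord0 j).
  move=> s0 j; rewrite /ulsf; have := neq_lift ord0 j.
  by rewrite -(inj_eq (@perm_inj _ s)) s0; case/unlift_some=> k -> ->.
have ulsf_inj (s : 'S_n.+1) : s ord0 = ord0 -> injective (ulsf s).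
  by move=> s0 j k /(congr1 (@lift n.+1 ord0)); rewrite !ulsfK // => /perm_inj/lift_inj.
(* [usf] inverts the lift on permutations fixing 0; elsewhere 1 is a default value that the filter
   excludes. *)
pose usf (s : 'S_n.+1) : 'S_n :=
  if pselect (s ord0 = ord0) is left s0 then perm (ulsf_inj s s0) else 1%g.
rewrite (reindex_onto (lift_perm ord0 ord0) usf) => [|s]; last first.
  rewrite -(inj_eq (@perm_inj _ (tperm ord0 i * s)%g)) permKV permM tpermR => /eqP s0.
  apply/permP => j; case: (unliftP ord0 j) => [k|] ->; last by rewrite lift_perm_id.
  by rewrite lift_perm_lift /usf; case: pselect => [s0'|[]//]; rewrite permE; exact: ulsfK.
apply: eq_bigl => s; set t := lift_perm _ _ _.
have t0 : t ord0 = ord0 by rewrite lift_perm_id.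
rewrite -(inj_eq (@perm_inj _ (tperm ord0 i * t)%g)) permKV permM tpermR t0 eqxx /=.
apply/eqP/permP => j; rewrite /usf; case: pselect => [t0'|[]//].
by rewrite permE; apply: (@lift_inj n.+1 ord0); rewrite (ulsfK _ t0') lift_perm_lift.
Qed.

(** For i other than 0, the transposition (0 i) merges the cycle {0} into that of i, cancelling the
    cycle gained by lifting; for i = 0 it is the identity. *)
Lemma card_porbits_tperm_lift n (s : 'S_n) (i : 'I_n.+1) :
  #|porbits (tperm ord0 i * lift_perm ord0 ord0 s)%g|
  = (#|porbits s| + (i == ord0))%N.
Proof.
have := porbits_mul_tperm (lift_perm ord0 ord0 s) ord0 i.
rewrite /= card_porbits_lift_perm eq_sym.
case: (unliftP ord0 i) => [j|] ->; last first.
  by rewrite eqxx porbit_id /= !addn0 addn1.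
rewrite porbit_lift_perm (eq_sym (lift _ _)) (negPf (neq_lift _ _)) /=.
case: finset.imsetP => [[x _ /eqP]|_]; first by rewrite (negPf (neq_lift _ _)).
by lia.
Qed.

(** Over polynomials, [rising n 'X] is q_n; over scalars, [rising n x] is its value. *)
Definition rising {R : pzRingType} n (x : R) : R := \prod_(i < n) (x + i%:R).

Lemma risingS (R : comPzRingType) n (x : R) : rising n.+1 x = rising n x * (x + n%:R).
Proof. by rewrite /rising big_ord_recr. Qed.

(** Induction on n: of the n + 1 transpositions (0 i), the trivial one adds a cycle and contributes
    x, while the n others keep the count and contribute n. *)
Lemma sum_exp_porbits (R : comPzRingType) n (x : R) :
  \sum_(s : 'S_n) x ^+ #|porbits s| = rising n x.
Proof.
elim: n => [|n IH].
  rewrite /rising big_ord0 (bigD1 1%g) //= big1 ?addr0 => [|s /eqP[]]; last first.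
    by apply/permP => -[].
  by rewrite (_ : #|_| = 0%N) // eq_card0 // => A; apply/finset.imsetP => -[[]].
rewrite sum_perm_recl risingS -IH big_ord_recl /= mulrDr addrC.
under [in X in X + _]eq_bigr do under eq_bigr do
  rewrite card_porbits_tperm_lift (eq_sym (lift _ _)) (negPf (neq_lift _ _)) addn0.
under [in X in _ + X]eq_bigr do rewrite card_porbits_tperm_lift eqxx addn1 exprSr.
by rewrite sumr_const card_ord mulr_natr addrC mulr_suml.
Qed.

Lemma sum_stirling1_exp (R : comPzRingType) n (x : R) :
  \sum_(j < n.+1) (stirling1 n j)%:R * x ^+ j = rising n x.
Proof.
rewrite -sum_exp_porbits.
have lt_porbits (s : 'S_n) : (#|porbits s| < n.+1)%N.
  by rewrite ltnS (leq_trans (leq_imset_card _ _)) // cardT size_enum_ord.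
rewrite (partition_big (fun s => Ordinal (lt_porbits s)) xpredT) //=.
apply: eq_bigr => j _; rewrite (eq_bigr (fun=> x ^+ j)) => [|s /eqP<- //].
by rewrite sumr_const mulr_natl; congr (_ *+ _).
Qed.

(** * Set partitions and Stirling numbers of the second kind *)

(* Functions with kernel partition B are the injections of the blocks of B into U. *)
Lemma card_kernel_ffun (T U : finType) (B : {set {set T}}) :
  finset.partition B [set: T]%SET ->
  #|[set f : {ffun T -> U} | preim_partition f [set: T]%SET == B]%SET| = (#|U| ^_ #|B|)%N.
Proof.
move=> partB; have [/eqP covB trivB nB0] := and3P partB.
have memB x : finset.pblock B x \in B by rewrite finset.pblock_mem // covB finset.in_setT.
(* [phi g] is [g] applied to the block of a point; its image on injective [g] is exactly the set to
   be counted. *)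
pose phi (g : {ffun {b | b \in B} -> U}) : {ffun T -> U} :=
  [ffun x => g (exist _ (finset.pblock B x) (memB x))].
have repr (b : {b | b \in B}) : exists x, exist _ (finset.pblock B x) (memB x) = b.
  have /set0Pn[x xb] : val b != finset.set0.
    by apply/negP => /eqP b0; case/negP: nB0; rewrite -b0; apply: valP.
  by exists x; apply: val_inj; rewrite /= (def_pblock trivB _ xb) //; apply: valP.
have phi_inj : injective phi.
  move=> g h /ffunP gh; apply/ffunP => b; have [x <-] := repr b.
  by have := gh x; rewrite !ffunE.
rewrite -[#|B|]card_sig -card_inj_ffuns -(card_imset _ phi_inj).
apply/eq_card => f; rewrite finset.in_set; apply/eqP/finset.imsetP => [fB|[g]].
  have eqf x y : (y \in finset.pblock B x) = (f x == f y).
    rewrite -fB pblock_equivalence_partition ?finset.in_setT //.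
    by split=> // /eqP ->.
  (* The value of [g] on a block is that of [f] at a chosen representative; by [eqf] the choice does
     not matter. *)
  pose g : {ffun {b | b \in B} -> U} := [ffun b => f (projT1 (cid (repr b)))].
  have gE x : g (exist _ (finset.pblock B x) (memB x)) = f x.
    rewrite ffunE; case: cid => z /= /(congr1 val) /= zx.
    by apply/eqP; rewrite eq_sym -eqf -zx mem_pblock covB finset.in_setT.
  exists g; last by apply/ffunP => x; rewrite ffunE gE.
  rewrite finset.in_set; apply/injectiveP => b c.
  have [x <-] := repr b; have [y <-] := repr c; rewrite !gE => fxy.
  by apply: val_inj => /=; apply/esym/same_pblock; rewrite // eqf fxy.
rewrite finset.in_set => /injectiveP g_inj ->.
rewrite -[RHS](preim_partition_pblock partB).
apply: eq_imset => x; apply/finset.setP => y; rewrite !finset.in_set /= !ffunE.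
by rewrite (inj_eq g_inj) -val_eqE.
Qed.

(** Count all functions from n points to m points by their kernel partition, then by its number of
    blocks. *)
Lemma sum_stirling2_ffact n m :
  (\sum_(j < n.+1) stirling2 n j * m ^_ j = m ^ n)%N.
Proof.
have -> : (m ^ n = #|{ffun 'I_n -> 'I_m}|)%N by rewrite card_ffun !card_ord.
rewrite -sum1_card.
rewrite (partition_big (fun f : {ffun _} => preim_partition f [set: 'I_n]%SET)
  (fun B => finset.partition B [set: 'I_n]%SET)) => [|f _]; last exact: preim_partitionP.
have cardB (B : {set {set 'I_n}}) : finset.partition B [set: 'I_n]%SET -> (#|B| < n.+1)%N.
  move=> /and3P[/eqP covB trivB nB0]; rewrite ltnS.
  have sB : (\sum_(A in B) #|A| = n)%N by rewrite (eqP trivB) covB finset.cardsT card_ord.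
  rewrite -[leqRHS]sB -sum1_card; apply: leq_sum => b Bb; rewrite card_gt0.
  by apply: contraNneq nB0 => <-.
rewrite [RHS](partition_big (fun B : {set {set 'I_n}} => inord #|B| : 'I_n.+1) xpredT) //=.
apply: eq_bigr => j _.
rewrite (eq_bigr (fun=> m ^_ j)%N) => [|B /andP[partB /eqP Bj]].
  rewrite sum_nat_const; congr (_ * _)%N; apply: eq_card => B; rewrite !inE.
  rewrite unfold_in; case partB: (finset.partition _ _) => //=.
  by rewrite -val_eqE /= inordK // cardB.
rewrite -Bj inordK ?cardB // -[m in RHS](card_ord m) -card_kernel_ffun // -sum1_card.
by apply: eq_bigl => f; rewrite finset.in_set.
Qed.

(** * Forward differences of rising factorials *)

Lemma risingSl (R : comPzRingType) n (x : R) : rising n.+1 x = x * rising n (x + 1).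
Proof.
rewrite /rising big_ord_recl addr0; congr (_ * _); apply: eq_bigr => i _.
by rewrite -addrA -mulrS.
Qed.

Lemma natr_ffact (R : comPzRingType) m j :
  (m ^_ j)%:R = rising j (m%:R - j%:R + 1) :> R.
Proof.
elim: j => [|j IH]; first by rewrite /rising big_ord0.
rewrite ffactnSr natrM IH risingSl mulrS opprD (addrC (- _)) addrA addrNK mulrC.
(* Truncated and ring subtraction disagree only for m < j, where the other factor is already
   zero. *)
have [jm|mj] := leqP j m; first by rewrite natrB.
by rewrite -IH ffact_small // !mulr0.
Qed.

Fixpoint fdiff {R : pzRingType} (k : nat) (f : R -> R) (a : R) : R :=
  if k is k'.+1 then fdiff k' f (a + 1) - fdiff k' f a else f a.

(** Only the values of f at a, a + 1, a + 2, ... enter, so identities known merely at natural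
    numbers can be used under [fdiff]. *)
Lemma eq_fdiff (R : pzRingType) k (f g : R -> R) a :
  (forall i, f (a + i%:R) = g (a + i%:R)) -> fdiff k f a = fdiff k g a.
Proof.
elim: k a => [|k IH] a fg /=; first by have := fg 0%N; rewrite addr0.
by rewrite !IH // => i; rewrite -addrA -mulrS.
Qed.

Lemma fdiff_sum (R : comPzRingType) k (I : Type) (s : seq I) (c : I -> R)
    (F : I -> R -> R) a :
  fdiff k (fun x => \sum_(i <- s) c i * F i x) a = \sum_(i <- s) c i * fdiff k (F i) a.
Proof.
elim: k a => [|k IH] a //=.
by rewrite !IH -sumrB; apply: eq_bigr => i _; rewrite mulrBr.
Qed.

Lemma fdiff_shift (R : comPzRingType) k (f : R -> R) b a :
  fdiff k (fun x => f (x + b)) a = fdiff k f (a + b).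
Proof. by elim: k a => [|k IH] a //=; rewrite !IH addrAC. Qed.

(** Leibniz rule: the first difference of x is 1 and the higher ones vanish, leaving two terms. At k
    = 0 the coefficient kills the term with [k.-1]. *)
Lemma fdiff_mulX (R : comPzRingType) k (f : R -> R) a :
  fdiff k (fun x => x * f x) a = a * fdiff k f a + k%:R * fdiff k.-1 f (a + 1).
Proof.
elim: k a => [|k IH] a /=; first by rewrite mul0r addr0.
rewrite !IH; case: k {IH} => [|k] /=; first by ring.
by rewrite -[k.+2]addn2 -[k.+1]addn1 !natrD; ring.
Qed.

Lemma fdiff_mulX2 (R : comPzRingType) k (f : R -> R) a :
  fdiff k (fun x => x ^+ 2 * f x) a
  = a ^+ 2 * fdiff k f a + k%:R * (2 * a + 1) * fdiff k.-1 f (a + 1)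
    + k%:R * (k%:R - 1) * fdiff k.-2 f (a + 2).
Proof.
rewrite (@eq_fdiff _ _ _ (fun x => x * (x * f x))) => [|i]; last by rewrite mulrA expr2.
rewrite !fdiff_mulX; case: k => [|k] /=; first by ring.
by rewrite -[k.+1]addn1 !natrD (_ : a + 1 + 1 = a + 2); ring.
Qed.

Lemma derivn_comp_XaddC (R : comNzRingType) (p : {poly R}) c i :
  (p \Po ('X + c%:P))^`(i) = p^`(i) \Po ('X + c%:P).
Proof.
elim: i p => [|i IH] p; first by rewrite !derivn0.
by rewrite !derivSn deriv_comp derivD derivX derivC addr0 mulr1 IH.
Qed.

Lemma rising_comp_poly (R : comNzRingType) n (c : {poly R}) :
  rising n 'X \Po c = rising n c.
Proof.
elim: n => [|n IH]; first by rewrite /rising !big_ord0 comp_polyC.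
by rewrite !risingS comp_polyM IH comp_polyD comp_polyX -[n%:R]polyC_natr comp_polyC.
Qed.

(** Both q_n(X + 1) and q_n(X) contain the factor q_(n - 1)(X + 1), with cofactors X + n and X;
    differentiation commutes with the shift. *)
Lemma derivn_rising_diff (R : comNzRingType) n i (x : R) :
  (rising n 'X)^`(i).[x + 1] - (rising n 'X)^`(i).[x]
  = n%:R * (rising n.-1 'X)^`(i).[x + 1].
Proof.
have E : rising n 'X \Po ('X + 1%:P) - rising n 'X
    = n%:R *: (rising n.-1 'X \Po ('X + 1%:P)) :> {poly R}.
  rewrite !rising_comp_poly; case: n => [|n] /=.
    by rewrite /rising !big_ord0 subrr scale0r.
  rewrite risingS risingSl -mul_polyC polyC_natr -[n.+1]addn1 natrD polyC1; ring.
have /(congr1 (fun p : {poly R} => p^`(i).[x])) := E.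
rewrite derivnB derivnZ !derivn_comp_XaddC.
by rewrite hornerD hornerN hornerZ !horner_comp hornerD hornerX hornerC.
Qed.

Lemma fdiff_derivn_rising (R : comNzRingType) k n i (a : R) :
  fdiff k (fun x => (rising n 'X)^`(i).[x]) a
  = (n ^_ k)%:R * (rising (n - k) 'X)^`(i).[a + k%:R].
Proof.
elim: k a => [|k IH] a /=; first by rewrite subn0 addr0 mul1r.
rewrite !IH -mulrBr (addrAC a 1) derivn_rising_diff mulrA -natrM ffactnSr subnS.
by rewrite -addrA natr1.
Qed.

Lemma horner_rising (R : comNzRingType) n (x : R) : (rising n 'X).[x] = rising n x.
Proof.
rewrite /rising horner_prod; apply: eq_bigr => i _.
by rewrite hornerD hornerX -polyC_natr hornerC.
Qed.

(** * The r-Stirling numbers as differences and as coefficients *)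

Lemma fdiff_exp0 (R : comNzRingType) k n :
  fdiff k (fun x : R => x ^+ n) 0 = if (k <= n)%N then (k`! * stirling2 n k)%:R else 0.
Proof.
(* [F j] is the falling factorial of length j, written as q_j(x + 1 - j); at 0 its k-th difference
   is k! if j = k and zero otherwise. *)
pose F (j : 'I_n.+1) (x : R) := (rising j 'X)^`(0).[x + (1 - j%:R)].
rewrite (@eq_fdiff _ _ _ (fun x => \sum_(j < n.+1) (stirling2 n j)%:R * F j x)); last first.
  move=> i; rewrite add0r -natrX -sum_stirling2_ffact natr_sum; apply: eq_bigr => j _.
  by rewrite natrM natr_ffact /F derivn0 horner_rising addrCA addrC.
rewrite fdiff_sum.
have FE (j : 'I_n.+1) : fdiff k (F j) 0 = (j == k :> nat)%:R * k`!%:R.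
  rewrite /F (fdiff_shift _ k (fun x => (rising j 'X)^`(0).[x])) fdiff_derivn_rising derivn0 horner_rising add0r.
  have [jk|kj|->] := ltngtP j k; last by rewrite ffactnn subnn /rising big_ord0 mulr1 mul1r.
    by rewrite ffact_small // !mul0r.
  (* For k < j the remaining factor is the falling factorial of 0 of length j - k > 0. *)
  rewrite mul0r (_ : 1 - _ + _ = 0%:R - (j - k)%:R + 1).
    by rewrite -natr_ffact (@ffact_small 0) ?mulr0 // subn_gt0.
  by rewrite natrB 1?ltnW //; ring.
under eq_bigr do rewrite FE.
case: ifPn => [kn|nk]; last first.
  apply: big1 => j _; rewrite (_ : (j == k :> nat) = false) ?mul0r ?mulr0 //.
  by apply: contraNF nk => /eqP <-; rewrite -ltnS.
rewrite (bigD1 (Ordinal (kn : (k < n.+1)%N))) //= eqxx mul1r big1 ?addr0 => [|j jk].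
  by rewrite natrM mulrC.
by rewrite (_ : (j == k :> nat) = false) ?mul0r ?mulr0 //; apply: contraNF jk => /eqP jk; apply/eqP/val_inj.
Qed.

(** Moving the base point to 0 and expanding (x + r)^n binomially reproduces the defining sum of
    [rstirling2]. *)
Lemma fdiff_exp (R : realType) k n (r : R) :
  fdiff k (fun x : R => x ^+ n) r = k`!%:R * rstirling2 r n k.
Proof.
rewrite -[r in LHS]add0r -(fdiff_shift _ _ (fun x => x ^+ n)).
rewrite (@eq_fdiff _ _ _ (fun x => \sum_(j < n.+1) 'C(n, j)%:R * r ^+ (n - j) * x ^+ j));
  last first.
  move=> i; rewrite addrC exprDn; apply: eq_bigr => j _.
  by rewrite -mulr_natl mulrA.
rewrite fdiff_sum /rstirling2 mulr_sumr [RHS]big_geq_mkord [RHS]big_mkcond /=.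
apply: eq_bigr => j _.
by rewrite fdiff_exp0; case: ifP => _; rewrite ?mulr0 // natrM; ring.
Qed.

Lemma coef_XaddC_exp (R : comNzRingType) j k (c : R) :
  (('X + c%:P) ^+ j)`_k = 'C(j, k)%:R * c ^+ (j - k).
Proof.
rewrite addrC exprDn coef_sum.
under eq_bigr do rewrite coefMn -polyC_exp mul_polyC coefZ coefXn.
have [kj|jk] := leqP k j; last first.
  rewrite bin_small // mul0r big1 // => i _; rewrite (_ : (k == i) = false) ?mulr0 ?mul0rn //.
  by apply/eqP => ki; have := ltn_ord i; rewrite -ki ltnNge => /negP; apply.
rewrite (bigD1 (Ordinal (kj : (k < j.+1)%N))) //= eqxx mulr1 big1 ?addr0 => [|i ik].
  by rewrite mulr_natl.
by rewrite (_ : (k == i) = false) ?mulr0 ?mul0rn //; apply: contraNF ik => /eqP ik; apply/eqP/val_inj.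
Qed.

Lemma rising_XaddC (R : realType) n (r : R) :
  rising n ('X + r%:P) = \poly_(k < n.+1) rstirling1 r n k.
Proof.
rewrite -sum_stirling1_exp; apply/polyP => k; rewrite coef_sum coef_poly.
under eq_bigr do rewrite -polyC_natr mul_polyC coefZ coef_XaddC_exp.
case: ltnP => [kn|nk].
  rewrite /rstirling1 big_geq_mkord [RHS]big_mkcond /=; apply: eq_bigr => j _.
  by case: leqP => [_|jk]; [rewrite mulrA | rewrite bin_small // mul0r mulr0].
by apply: big1 => j _; rewrite bin_small ?mul0r ?mulr0 // (leq_trans (ltn_ord j)).
Qed.

(** Multiplying the i-th derivative by x^i restores each power x^j with weight [j ^_ i]; then D^k at
    r turns x^j into k! {j k}_r. *)
Lemma sum_ffact_rstirling (R : realType) n k i (r : R) :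
  k`!%:R * \sum_(k <= j < n.+1) (j ^_ i)%:R * (rstirling1 r n j * rstirling2 r j k)
  = fdiff k (fun x => x ^+ i * (rising n 'X)^`(i).[x + r]) r.
Proof.
rewrite (@eq_fdiff _ _ _ (fun x => \sum_(j < n.+1) (j ^_ i)%:R * rstirling1 r n j * x ^+ j)).
  rewrite fdiff_sum big_geq_mkord [in LHS]big_mkcond /= mulr_sumr.
  apply: eq_bigr => j _; rewrite fdiff_exp; case: ifPn => [_|kj]; first by ring.
  rewrite [rstirling2 r j k]/rstirling2 big_geq ?mulr0 //.
  by rewrite ltnNge.
move=> l; set x := r + _.
have -> : (rising n 'X)^`(i).[x + r] = ((rising n 'X)^`(i) \Po ('X + r%:P)).[x].
  by rewrite horner_comp hornerD hornerX hornerC.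
rewrite -derivn_comp_XaddC rising_comp_poly rising_XaddC poly_def.
rewrite (raddf_sum (derivn i)) horner_sum mulr_sumr; apply: eq_bigr => j _.
rewrite /= derivnZ derivnXn hornerZ hornerMn hornerXn.
have [ij|ji] := leqP i j; last by rewrite ffact_small // mulr0n mulr0 !mulr0 !mul0r.
rewrite -[in RHS](subnK ij) exprD subnK // -mulr_natl; ring.
Qed.

(** * Logarithmic derivatives of rising factorials *)

(** This is H^(p)_(a + m - 1) - H^(p)_(a - 1), indexed from 0 to match the factors of
    [rising m a]. *)
Definition hsum {R : fieldType} (p m : nat) (a : R) : R :=
  \sum_(i < m) ((a + i%:R) ^+ p)^-1.

Lemma deriv_rising (R : realFieldType) m (a : R) : 0 < a ->
  (rising m 'X)^`(1).[a] = rising m a * hsum 1 m a.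
Proof.
move=> a0; elim: m => [|m IH].
  by rewrite /rising /hsum !big_ord0 mulr0 derivn1 derivC hornerC.
rewrite !risingS derivn1 derivM hornerD !hornerM -derivn1 IH horner_rising.
rewrite derivD derivX -polyC_natr derivC addr0 hornerD hornerX !hornerC.
rewrite /hsum big_ord_recr /=; have : a + m%:R != 0 by rewrite gt_eqF // ltr_wpDr.
by move=> ?; field.
Qed.

(** With l = q'/q one has q''/q = l^2 + l', and here l' is minus the sum of inverse squares. *)
Lemma deriv2_rising (R : realFieldType) m (a : R) : 0 < a ->
  (rising m 'X)^`(2).[a] = rising m a * (hsum 1 m a ^+ 2 - hsum 2 m a).
Proof.
move=> a0; elim: m => [|m IH].
  by rewrite /rising /hsum !big_ord0 expr0n subr0 mulr0 derivSn derivn1 !derivC hornerC.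
have := deriv_rising _ m _ a0; rewrite derivn1 => D1.
have dX : ('X + m%:R)^`() = 1 :> {poly R}.
  by rewrite derivD derivX -polyC_natr derivC addr0.
rewrite !risingS derivSn derivn1 derivM dX mulr1 derivD derivM dX mulr1.
have <- : (rising m 'X)^`(2) = (rising m 'X)^`()^`() :> {poly R} by rewrite derivSn derivn1.
rewrite -polyC_natr.
rewrite !hornerD hornerM IH D1 hornerD hornerX hornerC.
rewrite /hsum !big_ord_recr /=; have : a + m%:R != 0 by rewrite gt_eqF // ltr_wpDr.
by move=> ?; field.
Qed.

Lemma hsumS (R : fieldType) p m (a : R) : hsum p m.+1 a = hsum p m a + ((a + m%:R) ^+ p)^-1.
Proof. by rewrite /hsum big_ord_recr. Qed.

Lemma harmonic_diff_hsum (R : realType) p m (a : R) :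
  harmonic_diff p (a - 1) m = hsum p m a.
Proof.
rewrite /harmonic_diff /hsum big_add1 /= big_mkord; apply: eq_bigr => i _.
by rewrite mulrS addrA subrK.
Qed.

Lemma rising_gt0 (R : realFieldType) m (a : R) : 0 < a -> 0 < rising m a.
Proof. by move=> a0; apply: prodr_gt0 => i _; rewrite ltr_wpDr. Qed.

(** * Factorial moments of the r-Lah weights *)

Lemma fdiff_derivn_rising_shift (R : realType) l n i (r b : R) :
  fdiff l (fun x => (rising n 'X)^`(i).[x + r]) b
  = (n ^_ l)%:R * (rising (n - l) 'X)^`(i).[b + r + l%:R].
Proof. by rewrite (fdiff_shift _ l (fun x => (rising n 'X)^`(i).[x])) fdiff_derivn_rising. Qed.

(** Brings the Leibniz terms to the common factor [n ^_ k], which is absorbed by [rLah]; the factor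
    k covers k = 0, where [k.-1] is again 0. *)
Lemma natr_ffact_pred (R : realFieldType) n k : (k <= n)%N ->
  k%:R * (n ^_ k.-1)%:R = k%:R * (n ^_ k)%:R / ((n - k)%:R + 1) :> R.
Proof.
case: k => [|l] ln /=; first by rewrite !mul0r.
rewrite ffactnSr natrM natr1 -subSn // subSS.
have : (n - l)%:R != 0 :> R by rewrite pnatr_eq0 subn_eq0 -ltnNge.
by move=> ?; field.
Qed.

Lemma natr_ffact_pred2 (R : realFieldType) n k : (k <= n)%N ->
  k%:R * (k%:R - 1) * (n ^_ k.-2)%:R
  = k%:R * (k%:R - 1) * (n ^_ k)%:R / (((n - k)%:R + 1) * ((n - k)%:R + 2)) :> R.
Proof.
case: k => [|[|l]] ln /=; [by rewrite !mul0r | by rewrite subrr mulr0 !mul0r | ].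
have [m ->] : exists m, n = (l + m.+2)%N by exists (n - l.+2)%N; lia.
rewrite (_ : l + m.+2 - l.+2 = m)%N; last lia.
rewrite !ffactnSr !natrM (_ : l + m.+2 - l.+1 = m.+1)%N; last lia.
rewrite addKn -(addn1 m.+1) -(addn1 m) !natrD.
have m1 : m%:R + 1 != 0 :> R by rewrite natr1 pnatr_eq0.
have m2 : m%:R + 1 + 1 != 0 :> R by rewrite !natr1 pnatr_eq0.
by field; rewrite m1 (_ : m%:R + 2 = m%:R + 1 + 1) ?m2 //; ring.
Qed.

(** The zeroth moment: k! L(n,k)_r is D^k q_n(x + r) at x = r. *)
Lemma rLah_rising (R : realType) n k (r : R) : (k <= n)%N ->
  k`!%:R * rLah r n k = (n ^_ k)%:R * rising (n - k) (k%:R + 2 * r).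
Proof.
move=> kn; have := sum_ffact_rstirling _ n k 0 r.
under eq_bigr do rewrite ffactn0 mul1r.
rewrite -/(rLah r n k) => ->.
rewrite (@eq_fdiff _ _ _ (fun x => (rising n 'X)^`(0).[x + r])) => [|i]; last by rewrite mul1r.
rewrite fdiff_derivn_rising_shift derivn0 horner_rising; congr (_ * rising _ _); ring.
Qed.

Lemma rLah_gt0 (R : realType) n k (r : R) : (k <= n)%N -> 0 < k%:R + 2 * r ->
  0 < rLah r n k.
Proof.
move=> kn a0; rewrite -(pmulr_rgt0 _ (_ : 0 < k`!%:R)) ?ltr0n ?fact_gt0 // rLah_rising //.
by rewrite mulr_gt0 ?rising_gt0 // ltr0n ffact_gt0.
Qed.

Lemma rLah_factorial_moment1 (R : realType) n k (r : R) (a := k%:R + 2 * r) (m := (n - k)%N) :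
  (k <= n)%N -> 0 < a ->
  \sum_(k <= j < n.+1) (j ^_ 1)%:R * (rstirling1 r n j * rstirling2 r j k)
  = rLah r n k * (r * hsum 1 m a + k%:R * (n%:R + 2 * r) / (m%:R + 1) * hsum 1 m.+1 a).
Proof.
move=> kn a0; have k0 : k`!%:R != 0 :> R by rewrite pnatr_eq0 -lt0n fact_gt0.
apply: (mulfI k0); rewrite sum_ffact_rstirling mulrA rLah_rising // -/m -/a.
rewrite (@eq_fdiff _ _ _ (fun x => x * (rising n 'X)^`(1).[x + r])) => [|i]; last by rewrite expr1.
rewrite fdiff_mulX !fdiff_derivn_rising_shift -/m (_ : r + r + k%:R = a); last by rewrite /a; ring.
rewrite [k%:R * (_ * _)]mulrA natr_ffact_pred // -/m.
(* For k > 0 the degree n - (k - 1) is m + 1 and the point is a; for k = 0 both sides vanish. *)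
have -> : k%:R * (n ^_ k)%:R / (m%:R + 1) * (rising (n - k.-1) 'X)^`(1).[r + 1 + r + k.-1%:R]
    = k%:R * (n ^_ k)%:R / (m%:R + 1) * (rising m.+1 'X)^`(1).[a].
  case: k @a @m kn {a0 k0} => [|l] a m ln; first by rewrite !mul0r.
  rewrite /a /m /= -subSn // subSS; congr (_ * _.[_]).
  by rewrite -natr1; ring.
rewrite !deriv_rising // risingS.
(* This is the last factor of q_(m + 1)(a), the quotient of q_(m + 1)(a) by q_m(a). *)
have -> : a + m%:R = n%:R + 2 * r by rewrite /a /m natrB //; ring.
ring.
Qed.

(** The three terms of [fdiff_mulX2] give second derivatives of q_m, q_(m + 1), q_(m + 2), all at
    a. *)
Lemma rLah_factorial_moment2 (R : realType) n k (r : R) (a := k%:R + 2 * r) (m := (n - k)%N) :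
  (k <= n)%N -> 0 < a ->
  \sum_(k <= j < n.+1) (j ^_ 2)%:R * (rstirling1 r n j * rstirling2 r j k)
  = rLah r n k * (r ^+ 2 * (hsum 1 m a ^+ 2 - hsum 2 m a)
     + k%:R * (2 * r + 1) * (n%:R + 2 * r) / (m%:R + 1)
       * (hsum 1 m.+1 a ^+ 2 - hsum 2 m.+1 a)
     + k%:R * (k%:R - 1) * (n%:R + 2 * r) * (n%:R + 2 * r + 1)
       / ((m%:R + 1) * (m%:R + 2)) * (hsum 1 m.+2 a ^+ 2 - hsum 2 m.+2 a)).
Proof.
move=> kn a0; have k0 : k`!%:R != 0 :> R by rewrite pnatr_eq0 -lt0n fact_gt0.
apply: (mulfI k0); rewrite sum_ffact_rstirling mulrA rLah_rising // -/m -/a.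
rewrite fdiff_mulX2 !fdiff_derivn_rising_shift -/m (_ : r + r + k%:R = a); last by rewrite /a; ring.
rewrite [k%:R * (2 * r + 1) * (_ * _)]mulrA [k%:R * (2 * r + 1) * _]mulrAC natr_ffact_pred // -/m.
rewrite [k%:R * (k%:R - 1) * (_ * _)]mulrA natr_ffact_pred2 // -/m.
have -> : k%:R * (n ^_ k)%:R / (m%:R + 1) * (2 * r + 1)
      * (rising (n - k.-1) 'X)^`(2).[r + 1 + r + k.-1%:R]
    = k%:R * (n ^_ k)%:R / (m%:R + 1) * (2 * r + 1) * (rising m.+1 'X)^`(2).[a].
  case: k @a @m kn {a0 k0} => [|l] a m ln; first by rewrite !mul0r.
  rewrite /a /m /= -subSn // subSS; congr (_ * _.[_]).
  by rewrite -natr1; ring.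
have -> : k%:R * (k%:R - 1) * (n ^_ k)%:R / ((m%:R + 1) * (m%:R + 2))
      * (rising (n - k.-2) 'X)^`(2).[r + 2 + r + k.-2%:R]
    = k%:R * (k%:R - 1) * (n ^_ k)%:R / ((m%:R + 1) * (m%:R + 2))
      * (rising m.+2 'X)^`(2).[a].
  case: k @a @m kn {a0 k0} => [|[|l]] a m ln; [by rewrite !mul0r|by rewrite subrr mulr0 !mul0r|].
  rewrite /a /m /=; congr (_ * _.[_]); last by rewrite -!natr1; ring.
  by rewrite (_ : n - l = (n - l.+2).+2)%N //; lia.
rewrite !deriv2_rising // !risingS -[m.+1%:R]natr1 (addrA a).
have -> : a + m%:R = n%:R + 2 * r by rewrite /a /m natrB //; ring.
ring.
Qed.

Lemma rLah_admissible_gt0 (R : realType) n k (r : R) :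
  rLah_admissible n k r -> 0 < k%:R + 2 * r.
Proof.
move=> [_ _ r0]; rewrite lt_max => /orP[k0|rp]; first by rewrite ltr_wpDr // mulr_ge0.
by rewrite ltr_wpDl // mulr_gt0.
Qed.

Lemma rLah_moments_variance (R : realType) n k (r : R)
    (N := n%:R) (K := k%:R) (H1 := harmonic_diff 1 (K + 2 * r - 1) (n - k + 1))
    (H2 := harmonic_diff 2 (K + 2 * r - 1) (n - k + 1)) (L := rLah r n k)
    (S1 := \sum_(k <= j < n.+1) (j ^_ 1)%:R * (rstirling1 r n j * rstirling2 r j k))
    (S2 := \sum_(k <= j < n.+1) (j ^_ 2)%:R * (rstirling1 r n j * rstirling2 r j k)) :
  rLah_admissible n k r ->
  S2 / L + S1 / L - (S1 / L) ^+ 2 =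
  1 / ((N - K + 1) * (N - K + 2))
   * ((r * (N ^+ 2 + 3 * N + 2) + K ^+ 2 * (N + r)
       + K * (N ^+ 2 + r + 2 * N * r)) * H1
      - (r ^+ 2 * (N ^+ 2 + 3 * N + 2) + K ^+ 2 * (N + r) ^+ 2
         + K * (2 * N ^+ 2 * r + r * (2 + r)
                + N * (1 + 2 * r + 2 * r ^+ 2))) * H2
      - (K * (N + 1) * (N + 2 * r) * (K + 2 * r - 1) / (N - K + 1)) * H1 ^+ 2)
   - (r * N + r ^+ 2) / (N + 2 * r) ^+ 2.
Proof.
move=> hadm; have [n0 kn r0 _] := hadm.
have a0 : 0 < K + 2 * r := rLah_admissible_gt0 _ _ _ _ hadm.
have L0 : L != 0 by rewrite gt_eqF // rLah_gt0.
rewrite /S1 /S2 rLah_factorial_moment1 // rLah_factorial_moment2 // -/L.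
rewrite /H1 /H2 !harmonic_diff_hsum addn1 -/K {H1 H2}.
(* All sums are reduced to length n - k + 1: those one longer split off 1 / (n + 2r + 1)^p here, and
   those one shorter are corrected by 1 / (n + 2r)^p through [h]. The latter corrections yield the
   last summand, as 2r^2/v^2 - r/v - r^2/v^2 with v = n + 2r. *)
rewrite -/N !(hsumS _ _ (n - k).+1) !expr1.
have E : K + 2 * r + (n - k).+1%:R = N + 2 * r + 1.
  by rewrite -[(n - k).+1%:R]natr1 natrB // -/N -/K; ring.
have u0 : N + 2 * r + 1 != 0 by rewrite gt_eqF // /N ltr_wpDl // addr_ge0 // mulr_ge0.
have v0 : N + 2 * r != 0 by rewrite gt_eqF // /N ltr_wpDr ?ltr0n // mulr_ge0.
have h m p : hsum p m (K + 2 * r) = hsum p m.+1 (K + 2 * r) - ((K + 2 * r + m%:R) ^+ p)^-1.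
  by rewrite hsumS addrK.
rewrite !(h (n - k)%N) E.
have -> : K + 2 * r + (n - k)%:R = N + 2 * r by rewrite natrB // -/N -/K; ring.
have NK : (n - k)%:R = N - K by rewrite natrB.
have d1 : N - K + 1 != 0 by rewrite -NK natr1 pnatr_eq0.
have d2 : N - K + 2 != 0 by rewrite -NK -natrD pnatr_eq0 addn2.
rewrite NK; move: (hsum 1 _ _) (hsum 2 _ _) => H1 H2.
by field; rewrite L0 u0 v0 d1 d2.
Qed.

(** * From point masses to the variance *)

(** The masses on [s] add up to 1, so X lies in [s] almost surely and the integral reduces to the
    disjoint fibres, where the integrand is constant. *)
Lemma integral_finite_support (R : realType) (d : measure_display) (T : measurableType d)
    (P : probability T R) (X : {RV P >-> R}) (s : seq R) (p f : R -> R) :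
  uniq s -> (forall x, x \in s -> distribution P X [set x]%classic = (p x)%:E) ->
  \sum_(x <- s) p x = 1 -> measurable_fun setT f ->
  (\int[P]_w (f (X w))%:E = (\sum_(x <- s) f x * p x)%:E)%E.
Proof.
move=> us Xp p1 mf.
pose F (x : R) := (X @^-1` [set x])%classic.
have mX : measurable_fun setT X by [].
have mF x : measurable (F x) by rewrite /F -[X in measurable X]setTI; exact: mX.
have tF : trivIset [set` s]%classic F by apply/trivIset_preimage1.
have PF x : x \in s -> P (F x) = (p x)%:E by move=> /Xp.
pose D := (\big[setU/set0]_(x <- s) F x)%classic.
have mD : measurable D by apply: bigsetU_measurable => x _.
pose g : T -> \bar R := fun w => (f (X w))%:E.
have mg : measurable_fun setT g.
  by apply/measurable_EFinP; apply: measurableT_comp.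
have PD : P D = 1%E.
  (* Additivity of [P] over the fibres is read off from the integral of the constant 1. *)
  rewrite -[P D]mul1e -integral_cst // integral_bigsetU_EFin //; last exact: measurable_cst.
  under eq_bigr do rewrite integral_cst // mul1e.
  by rewrite big_seq (eq_bigr (fun x => (p x)%:E)) // -big_seq sumEFin p1.
have ae : ae_eq P setT g (g \_ D)%classic.
  exists (~` D)%classic; split; first exact: measurableC.
  - by have /= := @probability_setC _ _ _ P D mD; rewrite PD subee.
  - move=> w /= nfg Dw; apply: nfg => _.
    by rewrite patchE mem_set.
have mgD : measurable_fun setT (g \_ D)%classic.
  by apply/(measurable_restrictT _ mD); exact: measurable_funTS.
rewrite [LHS](ae_eq_integral (g \_ D)%classic g measurableT mg mgD ae).
rewrite -integral_mkcond integral_bigsetU_EFin //; last exact: measurable_funTS.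
rewrite -sumEFin big_seq [RHS]big_seq; apply: eq_bigr => x xs.
rewrite (eq_integral (cst (f x)%:E)); last by move=> w; rewrite inE /F /= => ->.
by rewrite integral_cst // EFinM -PF.
Qed.

Lemma variance_finite_support (R : realType) (d : measure_display) (T : measurableType d)
    (P : probability T R) (X : {RV P >-> R}) (s : seq R) (p : R -> R) :
  uniq s -> (forall x, x \in s -> distribution P X [set x]%classic = (p x)%:E) ->
  \sum_(x <- s) p x = 1 ->
  'V_P[X] = (\sum_(x <- s) x ^+ 2 * p x - (\sum_(x <- s) x * p x) ^+ 2)%:E.
Proof.
move=> us Xp p1; set c := \sum_(x <- s) x * p x.
have EX : ('E_P[X] = c%:E)%E.
  by rewrite unlock (integral_finite_support _ _ _ _ X s p id).
rewrite /variance covariance.unlock EX /= unlock.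
under eq_integral do rewrite /= -expr2.
rewrite (integral_finite_support _ _ _ _ X s p (fun x => (x - c) ^+ 2)) //; last first.
  by apply: measurable_funX; apply: measurable_funB.
congr (_%:E); rewrite (eq_bigr (fun x => x ^+ 2 * p x - 2 * c * (x * p x) + c ^+ 2 * p x)).
  by rewrite big_split /= sumrB -!mulr_sumr p1 -/c; ring.
by move=> x _; ring.
Qed.

Theorem theorem3p7 (R : realType) (d : measure_display) (T : measurableType d)
    (P : probability T R) (X : {RV P >-> R}) (n k : nat) (r : R)
    (hadm : rLah_admissible n k r) (hX : rLah_distributed X n k r) :
  let N : R := n%:R in
  let K : R := k%:R in
  let H1 : R := harmonic_diff 1 (K + 2 * r - 1) (n - k + 1) in
  let H2 : R := harmonic_diff 2 (K + 2 * r - 1) (n - k + 1) in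
  'V_P[X] =
  (1 / ((N - K + 1) * (N - K + 2))
   * ((r * (N ^+ 2 + 3 * N + 2) + K ^+ 2 * (N + r)
       + K * (N ^+ 2 + r + 2 * N * r)) * H1
      - (r ^+ 2 * (N ^+ 2 + 3 * N + 2) + K ^+ 2 * (N + r) ^+ 2
         + K * (2 * N ^+ 2 * r + r * (2 + r)
                + N * (1 + 2 * r + 2 * r ^+ 2))) * H2
      - (K * (N + 1) * (N + 2 * r) * (K + 2 * r - 1) / (N - K + 1)) * H1 ^+ 2)
   - (r * N + r ^+ 2) / (N + 2 * r) ^+ 2)%:E.
Proof.
move=> N K H1 H2; have [_ kn _ _] := hadm; have a0 := rLah_admissible_gt0 _ _ _ _ hadm.
rewrite -(rLah_moments_variance _ _ _ _ hadm).
have L0 : rLah r n k != 0 by rewrite gt_eqF // rLah_gt0.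
pose w j := rstirling1 r n j * rstirling2 r j k.
pose s : seq R := [seq j%:R | j <- index_iota k n.+1].
(* [Num.truncn] recovers the index j from the real value [j%:R]. *)
pose p (x : R) := (rLah r n k)^-1 * w (Num.truncn x).
have sumS (f : R -> R) :
    \sum_(x <- s) f x * p x = (\sum_(k <= j < n.+1) f j%:R * w j) / rLah r n k.
  rewrite big_map mulr_suml; apply: eq_bigr => j _.
  by rewrite /p natrK mulrCA mulrC mulrA.
rewrite (variance_finite_support _ _ _ _ X s p).
- congr (_%:E); rewrite (sumS (fun x => x ^+ 2)) (sumS id) -mulrDl -big_split /=.
  congr (_ / _ - (_ / _) ^+ 2); apply: eq_bigr => j _; rewrite -/(w j); last by rewrite ffactn1.
  (* Here j^2 = j (j - 1) + j. *)
  rewrite -mulrDl -natrD -natrX; congr (_%:R * _).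
  by case: j => // j; rewrite ffactnS ffactn1 ffactn1; lia.
- by rewrite map_inj_uniq ?iota_uniq //; apply: mulrIn; rewrite oner_eq0.
- move=> x /mapP[j]; rewrite mem_index_iota => /andP[kj jn] ->.
  by rewrite hX ?kj // /p natrK.
(* The weights [w] sum to [rLah r n k] by definition, hence total mass 1. *)
- have := sumS (fun=> 1); under eq_bigr do rewrite mul1r.
  by move=> ->; under eq_bigr do rewrite mul1r; rewrite divff.
Qed.
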